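(* Let $G=(V\cup P,E)$ be the graph of a rectangular warehouse with $m\ge 1$ aisles and $n\ge 2$ cross-aisles. Let $T\subseteq G$ be a minimal tour subgraph in which the double-traversal configuration (v) does not occur on any aisle segment (as defined in the context), and let $i\in\{0,\dots,m-1\}$ be an aisle. If all horizontal edges of $T$ incident to the vertices of aisle $i$ are known, then the vertical edge configurations of $T$ within aisle $i$ are uniquely determined. Explicitly: if $T$ and $T'$ are two minimal tour subgraphs of the same warehouse graph $G$, in neither of which configuration (v) occurs, and if for every $j\in\{0,\dots,n-1\}$ the multiplicities of the horizontal edges $v_{i-1,j}v_{i,j}$ and $v_{i,j}v_{i+1,j}$ (where these neighbours exist) are the same in $T$ and in $T'$, then $T$ and $T'$ have the same vertical edge configuration on each segment of aisle $i$.
   Context: **Warehouse graph.** A rectangular warehouse has a single depot, $m\ge1$ vertical aisles $i=0,\dots,m-1$ (left to right) and $n\ge2$ horizontal cross-aisles $j=0,\dots,n-1$ (bottom to top). The distances between adjacent aisles and between adjacent cross-aisles are uniform. The vertex $v_{i,j}\in V$ is the intersection of aisle $i$ and cross-aisle $j$. The part of aisle $i$ between $v_{i,j}$ and $v_{i,j+1}$ is a subaisle; the horizontal distance to traverse a subaisle is negligible. $P=\{p_0,\dots,p_q\}$ is the set of locations to be visited: $p_0$ is the depot and $p_1,\dots,p_q$ are products (picks). Only $p_0$ may coincide with some $v_{i,j}$; all other elements of $P$ lie inside subaisles. The graph $G=(V\cup P,E)$ has two parallel copies of each edge. Its horizontal edges join $v_{i,j}$ and $v_{i+1,j}$; its vertical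 edges join consecutive vertices of $V\cup P$ along an aisle. Edge lengths are the physical distances. **Tour subgraphs.** A subgraph $T\subseteq G$ is a tour subgraph if it contains every vertex of $P$ and there is a closed tour using each edge of $T$ exactly once; equivalently, every vertex of $P$ is in $T$, $T$ is connected, and every vertex of $T$ has even degree. A tour subgraph is minimal if its total edge length is minimum among all tour subgraphs. **Horizontal degree.** For $T$, let $m(u,w)$ be the number of parallel edges of $T$ directly between $u,w\in V$. Define $d_H(v_{i,j})=m(v_{i-1,j},v_{i,j})+m(v_{i,j},v_{i+1,j})$, a term being $0$ if the neighbour does not exist. **Segments.** Vertical configurations are considered over merged subaisle segments. A merged subaisle segment of aisle $i$ is the part of the aisle between $v_{i,j}$ and $v_{i,k}$ with $k>j+1$ such that $d_H(v_{i,\ell})=0$ for all $j<\ell<k$; it is treated as a single combined subaisle. The segments of aisle $i$ are obtained by cutting the aisle at the vertices with $d_H>0$ (together with the end vertices $v_{i,0}$ and $v_{i,n-1}$), so each segment is either a single subaisle or a merged subaisle segment. **Vertical configurations** on a segment with lower endpoint $a$ and upper endpoint $b$: (i) 1pass: one single pass along the whole segment from $a$ to $b$. (ii) Top: double edges from $b$ down to the farthest location of $P$ in the segment, leaving the rest of the segment untraveled. (iii) Bottom: double edges from $a$ up to the farthest location of $P$ in the segment, leaving the rest untraveled. (iv) Gap: double edges from $a$ upward and double edges from $b$ downward, together visiting every location of $P$ in the segment, chosen so as to maximize the untraveled length left between them. (v) 2pass: the whole segment from $a$ to $b$ is traversed twice (double edges throughout). (vi) None: no vertical edges in the segment; applies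 only when there are no locations of $P$ to visit in it.
   Formalization: Ties break literal uniqueness (e.g. a lone product mid-aisle: Top or Bottom), and a tour within one aisle may match none of (i)–(vi); so ''same configuration'' means identical vertical edges or a configuration realized by both, where Gap may have one side of length zero. *)

(* Defs.v *)
From HB Require Import structures.
From mathcomp Require Import all_boot all_order all_algebra.
From mathcomp Require Import finmap.
Set Implicit Arguments.
Unset Strict Implicit.
Unset Printing Implicit Defensive.
Import Order.TTheory GRing.Theory Num.Theory.
Local Open Scope fset_scope.
Local Open Scope ring_scope.

(* A point is (aisle index, height above cross-aisle 0). *)
Notation point R := (nat * R)%type.

Definition inside_subaisle (R : realFieldType) (n : nat) (dy y : R) : Prop :=
  exists2 j : nat, (j.+1 < n)%N & j%:R * dy < y < j.+1%:R * dy.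

(* m aisles, n cross-aisles, spacings dx and dy.  Location ord0 is the depot,
   the q others are the products. *)
Record warehouse (R : realFieldType) (m n q : nat) := Warehouse {
  dx : R;
  dy : R;
  loc : 'I_q.+1 -> point R;
  dx_gt0 : 0 < dx;
  dy_gt0 : 0 < dy;
  loc_inj : injective loc;
  loc_aisle : forall k, ((loc k).1 < m)%N;
  depot_place :
    (exists2 j : nat, (j < n)%N & (loc ord0).2 = j%:R * dy)
    \/ inside_subaisle n dy (loc ord0).2;
  product_place : forall k, k != ord0 -> inside_subaisle n dy (loc k).2
}.

Section Graph.
Variables (R : realFieldType) (m n q : nat) (W : warehouse R m n q).

Definition crossing (i j : nat) : point R := (i, j%:R * dy W).

Definition crossings : {fset point R} :=
  [fset crossing (nat_of_ord i) (nat_of_ord j) | i : 'I_m, j : 'I_n].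

Definition locations : {fset point R} := [fset loc W k | k : 'I_q.+1].

(* Using points as vertices identifies the depot with the crossing at which
   it may be placed. *)
Definition vertex : finType := crossings `|` locations.

Definition hlink (u v : vertex) : bool :=
  [&& val u \in crossings, val v \in crossings,
      (val v).1 == (val u).1.+1 & (val v).2 == (val u).2].

Definition vlink (u v : vertex) : bool :=
  [&& (val v).1 == (val u).1, (val u).2 < (val v).2
    & [forall x : vertex, ((val x).1 == (val u).1) ==>
         ~~ ((val u).2 < (val x).2 < (val v).2)]].

(* Every link is oriented rightwards or upwards, and comes in two parallel
   copies, told apart by the boolean. *)
Definition edge : finType :=
  ({e : vertex * vertex | hlink e.1 e.2 || vlink e.1 e.2} * bool)%type.

Definition src (e : edge) : vertex := (val e.1).1.
Definition tgt (e : edge) : vertex := (val e.1).2.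

Definition joins (e : edge) (u v : point R) : bool :=
  ((val (src e) == u) && (val (tgt e) == v))
  || ((val (src e) == v) && (val (tgt e) == u)).

Definition edge_length (e : edge) : R :=
  if hlink (src e) (tgt e) then dx W else (val (tgt e)).2 - (val (src e)).2.

Record subgraph := Subgraph {
  verts : {set vertex};
  edges : {set edge};
  edges_verts : forall e, e \in edges -> src e \in verts /\ tgt e \in verts
}.

Implicit Type T : subgraph.

Definition mult T (u v : point R) : nat := #|[set e in edges T | joins e u v]|.

Definition degree T (v : vertex) : nat :=
  #|[set e in edges T | (src e == v) || (tgt e == v)]|.

Definition sub_adj T : rel vertex :=
  [rel u v | [exists e in edges T, joins e (val u) (val v)]].

Definition connected T : Prop :=
  {in verts T &, forall u v, connect (sub_adj T) u v}.

Definition tour_subgraph T : Prop :=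
  [/\ forall v : vertex, val v \in locations -> v \in verts T,
      connected T
    & forall v, v \in verts T -> ~~ odd (degree T v)].

Definition total_length T : R := \sum_(e in edges T) edge_length e.

Definition minimal_tour_subgraph T : Prop :=
  tour_subgraph T /\
  forall T', tour_subgraph T' -> total_length T <= total_length T'.

(* Multiplicity of the horizontal edge from v_{i,j} to v_{i+1,j}; it is 0 when
   one of these is not a crossing of the warehouse. *)
Definition hmult T (i j : nat) : nat := mult T (crossing i j) (crossing i.+1 j).

Definition hdegree T (i j : nat) : nat :=
  ((if i is i'.+1 then hmult T i' j else 0) + hmult T i j)%N.

Definition cut T (i j : nat) : bool :=
  [|| j == 0, j == n.-1 | 0 < hdegree T i j]%N.

(* Single (k = j + 1) or merged (k > j + 1) subaisle segment of aisle i,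
   between cross-aisles j and k. *)
Definition segment T (i j k : nat) : Prop :=
  [/\ (j < k < n)%N, cut T i j, cut T i k
    & forall l, (j < l < k)%N -> hdegree T i l = 0%N].

Definition vmult_between T (i : nat) (x y : R) (c : nat) : Prop :=
  forall u v : vertex, vlink u v -> (val u).1 = i ->
    x <= (val u).2 -> (val v).2 <= y -> mult T (val u) (val v) = c.

(* Locations belonging to a segment are those strictly between its ends; the
   only one that can sit at an end is the depot. *)
Definition stop (i : nat) (x y z : R) : Prop :=
  (i, z) \in locations /\ x < z < y.

Variant configuration := OnePass | Top | Bottom | Gap | TwoPass | NoneCfg.

(* In Gap, x and y bound the untraveled part, and one of the two double
   traversals may be empty when the longest untraveled part touches an end of
   the segment.  So Top or Bottom edges can also realize Gap. *)
Definition has_configuration T (i j k : nat) (c : configuration) : Prop :=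
  let a := j%:R * dy W in
  let b := k%:R * dy W in
  match c with
  | OnePass => vmult_between T i a b 1
  | Top => exists z, [/\ stop i a b z, forall z', stop i a b z' -> z <= z',
             vmult_between T i z b 2 & vmult_between T i a z 0]
  | Bottom => exists z, [/\ stop i a b z, forall z', stop i a b z' -> z' <= z,
             vmult_between T i a z 2 & vmult_between T i z b 0]
  | Gap =>
      (exists z, stop i a b z) /\
      exists x y,
        [/\ a <= x <= y /\ y <= b,
            vmult_between T i a x 2 /\ vmult_between T i y b 2,
            vmult_between T i x y 0,
            forall z, ~ stop i x y z
          & forall x' y', a <= x' <= y' -> y' <= b ->
              (forall z, ~ stop i x' y' z) -> y' - x' <= y - x]
  | TwoPass => vmult_between T i a b 2
  | NoneCfg => (forall z, ~ stop i a b z) /\ vmult_between T i a b 0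
  end.

Definition no_two_pass T : Prop :=
  forall i j k, (i < m)%N -> segment T i j k ->
    ~ has_configuration T i j k TwoPass.

Definition same_vertical_edges T T' (i j k : nat) : Prop :=
  forall u v : vertex, vlink u v -> (val u).1 = i ->
    j%:R * dy W <= (val u).2 -> (val v).2 <= k%:R * dy W ->
    mult T (val u) (val v) = mult T' (val u) (val v).

(* Two tour subgraphs can realize the same Gap configuration with different
   edges, when several untraveled parts have the same maximal length.
   Conversely, a tour subgraph contained in a single aisle may realize none of
   the six configurations (e.g. depot and products all inside one subaisle);
   having the same configuration then means having the same edges. *)
Definition same_vertical_configuration T T' (i j k : nat) : Prop :=
  same_vertical_edges T T' i j k \/
  exists c, has_configuration T i j k c /\ has_configuration T' i j k c.

End Graph.

(* Main.v *)
Require Import Defs.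
From mathcomp Require Import all_boot all_order all_algebra.
From mathcomp Require Import finmap lra.

(** Let [T] be a minimal tour subgraph without doubled segments, and fix an
    aisle.  A segment has no horizontal edges strictly between its ends, so it
    is a path whose inner vertices have even degree, and all its links have
    the same parity ([within_parity]).  This parity is read off the horizontal
    edges: the set of vertices of the aisle up to a given height is left by an
    even number of edges of [T], which are horizontal except for the copies of
    one vertical link ([same_parity], from [handshake]).

    On an odd segment every link is single, which is the one-pass
    configuration.  On an even segment every link is absent or doubled, and
    some link is absent.  Absent links cannot enclose a vertex of [T]: the
    vertices between them would be cut off from an end of the segment that has
    horizontal edges.  So the untraveled links fill one interval with no
    location inside ([untraveled_block]).  Replacing this interval by another
    location-free one keeps all parities, and also keeps [T] connected, since
    [T] already connects the two ends of the segment without the segment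
    itself; minimality then makes the untraveled interval as long as possible
    ([gap_maximal]).  If both ends have horizontal edges this is the gap
    configuration.  An end without horizontal edges is an end of the aisle,
    and a doubled stretch starting there would be cut off, so the interval
    starts at that end and goes up to the first location: this is the top or
    the bottom configuration ([even_segment_configuration]).  With no location
    to visit the whole segment is untraveled.

    There remains an aisle without any horizontal edge.  Either [T] does not
    meet it, or [T] lies inside it and is the doubled path from its lowest to
    its highest location ([lone_aisle]); both descriptions depend on the
    locations only. *)

Set Implicit Arguments.
Unset Strict Implicit.
Unset Printing Implicit Defensive.
Import Order.TTheory GRing.Theory Num.Theory.
Local Open Scope ring_scope.

(* Only comparisons and equations between heights are left for [lra], which
   fails on equations between aisle indices and is slow on large contexts. *)
Ltac height_lra :=
  repeat match goal with
  | H : ?P |- _ =>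
    lazymatch P with
    | is_true (Order.le _ _) => fail
    | is_true (Order.lt _ _) => fail
    | @eq (Num.RealField.sort _) _ _ => fail
    | _ => clear H
    end
  end; lra.

Section Warehouse.
Variables (R : realFieldType) (m n q : nat) (W : warehouse R m n q).

Definition aisle (w : vertex W) : nat := (val w).1.
Definition height (w : vertex W) : R := (val w).2.

Implicit Types (a b u v w x y : vertex W) (e : edge W) (T : subgraph W).
Implicit Types (E : {set edge W}) (i j k : nat) (p r : R).

(** * Vertices and links of an aisle *)

Lemma vertex_eq u v : aisle u = aisle v -> height u = height v -> u = v.
Proof.
by move=> ha hh; apply: val_inj; apply/eqP; rewrite -pair_eqE; apply/andP; split; apply/eqP.
Qed.

Lemma crossingP u : val u \in crossings W ->
  exists i j, [/\ (i < m)%N, (j < n)%N & val u = crossing W i j].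
Proof. by case/imfset2P => a _ [b _ ->]; exists a, b; split. Qed.

Lemma mem_crossings i j : (i < m)%N -> (j < n)%N -> crossing W i j \in crossings W.
Proof.
move=> hi hj; apply/imfset2P; exists (Ordinal hi) => //.
by exists (Ordinal hj).
Qed.

Lemma crossing_vertex i j : (i < m)%N -> (j < n)%N ->
  exists w, val w = crossing W i j.
Proof.
move=> hi hj.
have hw : crossing W i j \in (crossings W `|` locations W)%fset.
  by rewrite in_fsetU mem_crossings.
by exists (FSetSub hw).
Qed.

Lemma location_vertex (c : point R) : c \in locations W -> exists w, val w = c.
Proof.
move=> hc.
have hw : c \in (crossings W `|` locations W)%fset by rewrite in_fsetU hc orbT.
by exists (FSetSub hw).
Qed.

Lemma crossing_le j k : (j%:R * dy W <= k%:R * dy W) = (j <= k)%N.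
Proof. by rewrite ler_pM2r ?ler_nat // dy_gt0. Qed.

Lemma crossing_lt j k : (j%:R * dy W < k%:R * dy W) = (j < k)%N.
Proof. by rewrite ltr_pM2r ?ltr_nat // dy_gt0. Qed.

Lemma inside_subaisle_bounds p : inside_subaisle n (dy W) p ->
  0 <= p <= n.-1%:R * dy W.
Proof.
case=> j hj /andP[h1 h2]; apply/andP; split.
  by apply: le_trans (ltW h1); rewrite mulr_ge0 ?ler0n // ltW // dy_gt0.
by apply: le_trans (ltW h2) _; rewrite crossing_le; case: (n) hj.
Qed.

Lemma height_bounds w : 0 <= height w <= n.-1%:R * dy W.
Proof.
have hcr j : (j < n)%N -> 0 <= j%:R * dy W <= n.-1%:R * dy W.
  move=> hj; rewrite mulr_ge0 ?ler0n ?(ltW (dy_gt0 W)) //= crossing_le.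
  by case: (n) hj.
have := valP w; rewrite /height in_fsetU => /orP[/crossingP[a [b [_ hb ->]]]|].
  exact: hcr.
case/imfsetP => l _ ->.
case: (eqVneq l ord0) => [->|hl]; last exact/inside_subaisle_bounds/product_place.
case: (depot_place W) => [[j hj ->]|]; first exact: hcr.
exact: inside_subaisle_bounds.
Qed.

Lemma aisle_lt w : (aisle w < m)%N.
Proof.
have := valP w; rewrite /aisle in_fsetU => /orP[/crossingP[i [j [hi _ ->]]] //|].
by case/imfsetP => l _ ->; apply: loc_aisle.
Qed.

Lemma vlinkP u v : vlink u v ->
  [/\ aisle v = aisle u, height u < height v
    & forall w, aisle w = aisle u -> height w <= height u \/ height v <= height w].
Proof.
case/and3P => /eqP ha hh /forallP hb; split=> // w /eqP hw.
have := hb w; rewrite /aisle in hw; rewrite hw /= negb_and -!leNgt.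
by case/orP; [left|right].
Qed.

Lemma hlink_vlinkF u v : hlink u v -> vlink u v -> False.
Proof.
by case/and4P => _ _ /eqP E _ /vlinkP[]; rewrite /aisle E => /eqP; rewrite eqn_leq ltnn.
Qed.

Lemma hlink_crossing e : hlink (src e) (tgt e) -> exists i j,
  [/\ (i.+1 < m)%N, (j < n)%N, val (src e) = crossing W i j
    & val (tgt e) = crossing W i.+1 j].
Proof.
case/and4P => /crossingP[i [j [hi hj E]]] _ /eqP a1 /eqP a2.
exists i, j; split=> //.
  by have := aisle_lt (tgt e); rewrite /aisle a1 E.
by move: a1 a2; rewrite E; case: (val (tgt e)) => c d /= -> ->.
Qed.

Lemma vlink_next u w : aisle w = aisle u -> height u < height w ->
  exists2 v, vlink u v & height v <= height w.
Proof.
move=> ha hh.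
pose above z := (aisle z == aisle u) && (height u < height z).
have hw : above w by rewrite /above ha eqxx.
case: (arg_minP (P := above) height hw) => v /andP[/eqP av hv] hmin.
exists v; last exact: hmin.
rewrite /vlink; apply/and3P; split=> //; first exact/eqP.
apply/forallP => z; apply/implyP => hz; apply/negP => /andP[h1 h2].
have /hmin : above z by rewrite /above; apply/andP; split.
by rewrite leNgt h2.
Qed.

Lemma vlink_prev u w : aisle u = aisle w -> height u < height w ->
  exists2 v, vlink v w & height u <= height v.
Proof.
move=> ha hh.
pose below z := (aisle z == aisle w) && (height z < height w).
have hu : below u by rewrite /below ha eqxx.
case: (arg_maxP (P := below) height hu) => v /andP[/eqP av hv] hmax.
exists v; last exact: hmax.
rewrite /vlink; apply/and3P; split=> //; first exact/eqP.
apply/forallP => z; apply/implyP => hz; apply/negP => /andP[h1 h2].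
have /hmax : below z by rewrite /below -av; apply/andP; split.
by rewrite /= leNgt h1.
Qed.

(** Otherwise an end of one link would lie strictly between the ends of the
    other. *)
Lemma vlink_overlap u v u' v' : vlink u v -> vlink u' v' -> aisle u = aisle u' ->
  height u < height v' -> height u' < height v -> u = u' /\ v = v'.
Proof.
move=> /vlinkP[a1 h1 b1] /vlinkP[a2 h2 b2] ha l1 l2.
have ab (w w' : vertex W) : height w <= height w' -> height w' <= height w ->
    aisle w = aisle w' -> w = w'.
  by move=> w1 w2 aw; apply: vertex_eq => //; apply: le_anti; rewrite w1.
split; apply: ab; rewrite ?a1 ?a2 //.
- by case: (b2 u ha) => //; rewrite leNgt l1.
- by case: (b1 u' (esym ha)) => //; rewrite leNgt l2.
- by case: (b1 v' (etrans a2 (esym ha))) => //; rewrite leNgt l1.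
- by case: (b2 v (etrans a1 ha)) => //; rewrite leNgt l2.
Qed.

(** Going down from [v] one link at a time reaches every lower vertex of the
    aisle. *)
Lemma aisle_ind v (P : vertex W -> Prop) : P v ->
  (forall u u', vlink u u' -> aisle u = aisle v -> height u' <= height v ->
     P u' -> P u) ->
  forall u, aisle u = aisle v -> height u <= height v -> P u.
Proof.
move=> Pv step u; have [N] := ubnP #|[set z | height u < height z]|.
elim: N u => // N IH u; rewrite ltnS => hN ha.
rewrite le_eqVlt => /orP[/eqP hh|hlt]; first by rewrite (vertex_eq ha hh).
have [u' L hu'] := vlink_next (esym ha) hlt.
have [au' huu' _] := vlinkP L.
apply: (step u u' L ha hu'); apply: IH hu'; last by rewrite au'.
apply: leq_trans hN; apply: proper_card; apply/properP; split.
  by apply/subsetP => z; rewrite !inE; apply: lt_trans.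
by exists u'; rewrite !inE ?ltxx.
Qed.

(** * Copies of a link *)

Lemma edge_linkP e : hlink (src e) (tgt e) \/ vlink (src e) (tgt e).
Proof. exact/orP/(valP e.1). Qed.

Lemma src_neq_tgt e : src e != tgt e.
Proof.
apply/eqP => E; case: (edge_linkP e).
  by rewrite E => /and4P[_ _ /eqP]; move/eqP; rewrite eqn_leq ltnn andbF.
by move/vlinkP=> []; rewrite E ltxx.
Qed.

Lemma link_eq e e' : src e = src e' -> tgt e = tgt e' -> e.1 = e'.1.
Proof.
move=> h1 h2; apply: val_inj.
by rewrite [LHS]surjective_pairing [RHS]surjective_pairing; congr pair.
Qed.

Lemma vlink_edge u v : vlink u v -> exists e, src e = u /\ tgt e = v.
Proof.
move=> L.
have H : hlink (u, v).1 (u, v).2 || vlink (u, v).1 (u, v).2 by rewrite /= L orbT.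
by exists (Sub (u, v) H, true).
Qed.

Lemma vlink_two_edges u v : vlink u v -> exists e0 e1 : edge W,
  e0 != e1 /\ forall e, (e \in pred2 e0 e1) = (src e == u) && (tgt e == v).
Proof.
move=> L; have [e [E1 E2]] := vlink_edge L.
exists (e.1, true), (e.1, false); split; first by apply/eqP => -[].
move=> e'; rewrite -E1 -E2; apply/idP/andP => [/orP[]/eqP -> //|[/eqP h1 /eqP h2]].
by move: (link_eq h1 h2); case: (e') => l [] /= ->; rewrite inE /= eqxx ?orbT.
Qed.

(** Here [l] is a link, that is, the first component of an edge. *)
Definition copies E l : nat := (((l, true) \in E) + ((l, false) \in E))%N.

Lemma card_links E (Q : pred {e | hlink e.1 e.2 || vlink e.1 e.2}) :
  #|[set e in E | Q e.1]| = (\sum_(l | Q l) copies E l)%N.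
Proof.
rewrite -sum1dep_card (eq_bigl (fun e : edge W => Q e.1 && ((e.1, e.2) \in E))); last first.
  by move=> [l b] /=; rewrite andbC.
rewrite -(pair_big_dep Q (fun l c => (l, c) \in E) (fun _ _ => 1%N)) /=.
apply: eq_bigr => l _; rewrite big_mkcond big_bool /copies.
by do 2 case: (_ \in E).
Qed.

(** Links are oriented, so two links never join the same points in opposite
    orders. *)
Lemma joinsE e e' : joins e' (val (src e)) (val (tgt e)) = (e'.1 == e.1).
Proof.
apply/idP/eqP => [|E]; last by rewrite /joins /src /tgt E !eqxx.
rewrite /joins => /orP[] /andP[/eqP/val_inj h1 /eqP/val_inj h2].
  by apply: val_inj; rewrite [LHS]surjective_pairing [RHS]surjective_pairing; congr pair.
exfalso; have := edge_linkP e'; rewrite h1 h2.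
case: (edge_linkP e) => [L|/vlinkP[a1 a2 _]].
  case/and4P: L => _ _ /eqP a1 /eqP a2.
  case=> [/and4P[_ _ /eqP + _]|/vlinkP[]].
    by rewrite a1 => /eqP; rewrite eqn_leq [X in _ && X]leqNgt ltnS leqnSn andbF.
  by rewrite /height a2 ltxx.
case=> [/and4P[_ _ /eqP + _]|/vlinkP[_ + _]].
  by rewrite -/(aisle _) -/(aisle _) a1 => /eqP; rewrite eqn_leq ltnn andbF.
by move/lt_trans/(_ a2); rewrite ltxx.
Qed.

Lemma mult_copies T e :
  mult T (val (src e)) (val (tgt e)) = copies (edges T) e.1.
Proof.
rewrite /mult -(big_pred1_eq addn e.1) -card_links.
by apply: eq_card => e'; rewrite !inE joinsE.
Qed.

Lemma copies_gt0 E l : (0 < copies E l)%N -> exists2 e : edge W, e \in E & e.1 = l.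
Proof.
rewrite /copies; case: (boolP ((l, true) \in E)) => [h _|_]; first by exists (l, true).
by case: (boolP ((l, false) \in E)) => [h _|_ //]; exists (l, false).
Qed.

Lemma copies_odd E e : odd (copies E e.1) -> copies E e.1 = 1%N.
Proof. by rewrite /copies; do 2 case: (_ \in E). Qed.

Lemma copies_even E e : ~~ odd (copies E e.1) ->
  copies E e.1 = (if e \in E then 2 else 0)%N.
Proof. by case: e => l [] /=; rewrite /copies; do 2 case: (_ \in E). Qed.

Lemma copies_even_eq E e e' : ~~ odd (copies E e.1) -> e.1 = e'.1 ->
  (e \in E) = (e' \in E).
Proof.
move=> ev El; have := copies_even ev; rewrite El in ev *; rewrite (copies_even ev).
by do 2 case: (_ \in E).
Qed.

Lemma copies_uniform E l (c : bool) : (forall e : edge W, e.1 = l -> (e \in E) = c) ->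
  copies E l = (if c then 2 else 0)%N.
Proof. by move=> h; rewrite /copies !h //; case: c {h}. Qed.

(** * Stretches of an aisle *)

Definition within i p r e :=
  [&& vlink (src e) (tgt e), aisle (src e) == i, p <= height (src e)
    & height (tgt e) <= r].

Lemma within_link i p r (e e' : edge W) : e.1 = e'.1 -> within i p r e = within i p r e'.
Proof. by rewrite /within /src /tgt => ->. Qed.

(** No link passes over a vertex. *)
Lemma within_split i p r e x : aisle x = i -> within i p r e ->
  height (tgt e) <= height x \/ height x <= height (src e).
Proof.
move=> ax /and4P[/vlinkP[_ _ /(_ x) H] /eqP ha _ _].
by case: H; rewrite ?ax ?ha //; [right|left].
Qed.

(** Both bounds are excluded: a slab between two vertices contains only
    vertices at which the horizontal edges are under control. *)
Definition slab i p r : {set vertex W} :=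
  [set w | (aisle w == i) && (p < height w < r)].

Lemma slab_crossed_vlink i p r e : vlink (src e) (tgt e) ->
  (src e \in slab i p r) (+) (tgt e \in slab i p r) ->
  aisle (src e) = i /\
  (height (src e) <= p < height (tgt e) \/ height (src e) < r <= height (tgt e)).
Proof.
case/vlinkP => ha hh _; rewrite !inE ha.
case: eqP => //= -> H; split=> //; move: H.
case: (ltP p (height (src e))); case: (ltP (height (src e)) r);
case: (ltP p (height (tgt e))); case: (ltP (height (tgt e)) r) => //= h1 h2 h3 h4 _.
all: try height_lra.
all: by [left; height_lra | right; lra].
Qed.

(** This is how segments enter the connectivity and parity arguments: a slab
    that is calm can only be left through its two bounding heights. *)
Definition calm T i p r := forall e, e \in edges T -> hlink (src e) (tgt e) ->
  src e \notin slab i p r /\ tgt e \notin slab i p r.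

Lemma calm_sub T i p r p' r' : calm T i p r -> p <= p' -> r' <= r -> calm T i p' r'.
Proof.
move=> hc h1 h2 e he /(hc e he); rewrite !inE => -[n1 n2].
by split; [move: n1|move: n2]; apply: contra => /andP[-> /=] /andP[? ?]; height_lra.
Qed.

Lemma horizontal_hdegree T e w : e \in edges T -> hlink (src e) (tgt e) ->
  w = src e \/ w = tgt e ->
  exists l, [/\ (l < n)%N, height w = l%:R * dy W & (0 < hdegree T (aisle w) l)%N].
Proof.
move=> he /hlink_crossing[i [j [_ hj E1 E2]]] hw.
have hm : (0 < hmult T i j)%N.
  rewrite /hmult -E1 -E2 card_gt0; apply/set0Pn; exists e.
  by rewrite inE he joinsE eqxx.
exists j; split=> //.
  by case: hw => ->; rewrite /height ?E1 ?E2.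
rewrite /hdegree; case: hw => ->; rewrite /aisle ?E1 ?E2 /=.
  by rewrite addn_gt0 hm orbT.
by rewrite addn_gt0 hm.
Qed.

Lemma hdegree_calm T i p r :
  (forall l, (l < n)%N -> p < l%:R * dy W < r -> hdegree T i l = 0%N) ->
  calm T i p r.
Proof.
move=> h0 e he hl.
suff H w : w = src e \/ w = tgt e -> w \notin slab i p r by split; apply: H; [left|right].
move=> hw; rewrite inE; apply/andP => -[/eqP ha hb].
have [l [ln hl' hd]] := horizontal_hdegree he hl hw.
by move: hd; rewrite ha h0 // -hl'.
Qed.

Lemma slab_crossed T i p r e : calm T i p r -> e \in edges T ->
  (src e \in slab i p r) (+) (tgt e \in slab i p r) ->
  [/\ vlink (src e) (tgt e), aisle (src e) = i
    & height (src e) <= p < height (tgt e) \/ height (src e) < r <= height (tgt e)].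
Proof.
move=> hc he hx; case: (edge_linkP e) => [/(hc e he)[h1 h2]|L].
  by move: hx; rewrite (negbTE h1) (negbTE h2).
by have [] := slab_crossed_vlink L hx.
Qed.

Lemma hdegree_verts T i j w : val w = crossing W i j -> (0 < hdegree T i j)%N ->
  w \in verts T.
Proof.
move=> hw; rewrite /hdegree addn_gt0.
have key c d : (0 < mult T c d)%N -> val w = c \/ val w = d -> w \in verts T.
  rewrite card_gt0 => /set0Pn[e]; rewrite inE => /andP[/edges_verts[h1 h2]].
  by case/orP => /andP[/eqP E1 /eqP E2]; rewrite -E1 -E2 => -[] /val_inj ->.
by case/orP; [case: i hw => // i hw|]; move/key; apply; [right|left].
Qed.

Lemma vmult_betweenP T i p r c : vmult_between T i p r c <->
  forall e, within i p r e -> copies (edges T) e.1 = c.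
Proof.
split=> [H e /and4P[L /eqP ai h1 h2]|H u v L ai h1 h2].
  by rewrite -mult_copies; apply: H.
have [e [E1 E2]] := vlink_edge L.
rewrite -E1 -E2 mult_copies; apply: H.
by apply/and4P; rewrite E1 E2; split=> //; apply/eqP.
Qed.

Lemma copies_same_vertical_edges T T' i j k :
  (forall e, within i (j%:R * dy W) (k%:R * dy W) e ->
     copies (edges T) e.1 = copies (edges T') e.1) ->
  same_vertical_edges T T' i j k.
Proof.
move=> h u v L ai h1 h2; have [e [E1 E2]] := vlink_edge L.
rewrite -E1 -E2 !mult_copies; apply: h.
by apply/and4P; rewrite E1 E2; split=> //; apply/eqP.
Qed.

(** * Parity *)

Lemma odd_sum (I : finType) (P : pred I) (F : I -> nat) :
  odd (\sum_(l | P l) F l) = \big[addb/false]_(l | P l) odd (F l).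
Proof. exact: (big_morph odd oddD). Qed.

Lemma tour_degree T v : tour_subgraph T -> ~~ odd (degree T v).
Proof.
case=> _ _ hdeg; have [/hdeg //|hv] := boolP (v \in verts T).
rewrite /degree eq_card0 // => e; rewrite !inE.
by apply/negP => /andP[/edges_verts[h1 h2] /orP[]/eqP E]; move: hv; rewrite -E ?h1 ?h2.
Qed.

(** Exchanging absent and doubled links preserves the parity of all degrees,
    which is what allows a segment to be rerouted link by link. *)
Lemma degree_parity T T' v : (forall l, odd (copies (edges T) l) = odd (copies (edges T') l)) ->
  odd (degree T v) = odd (degree T' v).
Proof.
move=> h.
have key T1 : degree T1 v =
    (\sum_(l | ((val l).1 == v) || ((val l).2 == v)) copies (edges T1) l)%N.
  exact: (card_links (edges T1) (fun l => ((val l).1 == v) || ((val l).2 == v))).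
by rewrite !key !odd_sum; apply: eq_bigr => l _.
Qed.

(** Summing the degrees over [A] counts an edge twice when both its ends are
    in [A] and once when exactly one of them is. *)
Lemma handshake T (A : {set vertex W}) : tour_subgraph T ->
  ~~ odd #|[set e in edges T | (src e \in A) (+) (tgt e \in A)]|.
Proof.
move=> tT; have: ~~ odd (\sum_(v in A) degree T v).
  by rewrite odd_sum big1 // => v _; apply/negbTE/tour_degree.
have -> : (\sum_(v in A) degree T v =
    \sum_(e in edges T) ((src e \in A) + (tgt e \in A)))%N.
  transitivity (\sum_(v in A) \sum_(e in edges T) ((src e == v) + (tgt e == v)))%N.
    apply: eq_bigr => v _; rewrite /degree -sum1dep_card big_mkcondr.
    apply: eq_bigr => e _; have := src_neq_tgt e.
    case: (eqVneq (src e) v) => [<-|_ _]; first by rewrite eq_sym => /negbTE ->.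
    by case: (tgt e == v).
  rewrite exchange_big; apply: eq_bigr => e _; rewrite big_split /=.
  congr addn; rewrite -big_mkcondr sum1dep_card;
  [case: (boolP (src e \in A))|case: (boolP (tgt e \in A))] => h.
  - by rewrite (eq_card1 (x := src e)) // => v; rewrite !inE andbC eq_sym; case: eqVneq => // ->.
  - by rewrite eq_card0 // => v; rewrite !inE andbC; case: eqVneq => // <-; apply/negbTE.
  - by rewrite (eq_card1 (x := tgt e)) // => v; rewrite !inE andbC eq_sym; case: eqVneq => // ->.
  - by rewrite eq_card0 // => v; rewrite !inE andbC; case: eqVneq => // <-; apply/negbTE.
rewrite -sum1dep_card !odd_sum [X in _ -> ~~ X]big_mkcondr /=.
congr (is_true (~~ _)); apply: eq_bigr => e _.
by rewrite oddD !oddb; case: (_ (+) _).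
Qed.

Lemma card_boundary E (A : {set vertex W}) :
  #|[set e in E | (src e \in A) (+) (tgt e \in A)]| =
  (\sum_(l | ((val l).1 \in A) (+) ((val l).2 \in A)) copies E l)%N.
Proof. exact: (card_links E (fun l => ((val l).1 \in A) (+) ((val l).2 \in A))). Qed.

(** The vertices strictly between the two links form a set that [T] can only
    leave through these links, so [handshake] makes their copies even in total. *)
Lemma within_parity T i p r e1 e2 : tour_subgraph T -> calm T i p r ->
  within i p r e1 -> within i p r e2 ->
  odd (copies (edges T) e1.1) = odd (copies (edges T) e2.1).
Proof.
move=> tT hc.
wlog hle : e1 e2 / height (src e1) <= height (src e2).
  move=> H h1 h2; have [hle|/ltW hle] := leP (height (src e1)) (height (src e2)).
    exact: H.
  by symmetry; apply: H.
case/and4P => L1 /eqP a1 p1 r1 /and4P[L2 /eqP a2 p2 r2].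
have [b1 s1 t1] := vlinkP L1; have [b2 s2 t2] := vlinkP L2.
move: hle; rewrite le_eqVlt => /orP[/eqP hh|hlt].
  have [] : src e1 = src e2 /\ tgt e1 = tgt e2.
    by apply: vlink_overlap => //; rewrite ?a1 // ?hh // -hh.
  by move=> h1 h2; rewrite (link_eq h1 h2).
have ht : height (tgt e1) <= height (src e2).
  by case: (t1 (src e2)); rewrite ?a2 ?a1 // => ?; height_lra.
pose A := slab i (height (src e1)) (height (tgt e2)).
have := handshake A tT.
rewrite card_boundary (bigD1 e1.1) /=; last first.
  by rewrite -/(src e1) -/(tgt e1) /A !inE b1 a1 eqxx ltxx s1 /=; height_lra.
rewrite (bigD1 e2.1) /=; last first.
  apply/andP; split.
    by rewrite -/(src e2) -/(tgt e2) /A !inE b2 a2 eqxx ltxx s2 hlt !andbF.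
  apply/eqP => E; have : src e2 = src e1 by rewrite /src E.
  by move=> E'; rewrite E' ltxx in hlt.
rewrite big1 ?addn0 ?oddD ?negb_add; first by move/eqP.
move=> l /andP[/andP[hx n1] n2].
apply/eqP; rewrite -leqn0 leqNgt; apply/negP => /copies_gt0[e he El].
move: hx; rewrite -El -/(src e) -/(tgt e) => hx.
have hc' : calm T i (height (src e1)) (height (tgt e2)).
  move=> e' he' /(hc e' he'); rewrite !inE => -[h1 h2].
  split; [move: h1|move: h2]; apply: contra => /andP[-> /=] /andP[? ?]; height_lra.
have [L a [/andP[c1 c2]|/andP[c1 c2]]] := slab_crossed hc' he hx.
  case/eqP: n1; rewrite -El; have [] := vlink_overlap L L1; rewrite ?a ?a1 //; first height_lra.
  by move=> h1 h2; apply: link_eq.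
case/eqP: n2; rewrite -El; have [] := vlink_overlap L L2; rewrite ?a ?a2 //; first height_lra.
by move=> h1 h2; apply: link_eq.
Qed.

(** Apply [handshake] to the vertices of the aisle up to the lower end of the
    link: besides the copies of the link itself, only horizontal edges leave
    this set, and they are as many in [T] as in [T']. *)
Lemma same_parity T T' i e0 : tour_subgraph T -> tour_subgraph T' ->
  (forall e, hlink (src e) (tgt e) -> aisle (src e) = i \/ aisle (tgt e) = i ->
     copies (edges T) e.1 = copies (edges T') e.1) ->
  vlink (src e0) (tgt e0) -> aisle (src e0) = i ->
  odd (copies (edges T) e0.1) = odd (copies (edges T') e0.1).
Proof.
move=> tT tT' hh L0 a0; have [b0 s0 t0] := vlinkP L0.
have /andP[g0 _] := height_bounds (src e0).
pose A := slab i (-1) (height (tgt e0)).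
have key T1 : tour_subgraph T1 -> odd (copies (edges T1) e0.1) =
    odd (\sum_(l | (((val l).1 \in A) (+) ((val l).2 \in A)) && (l != e0.1))
           copies (edges T1) l).
  move=> tT1; have := handshake A tT1.
  rewrite card_boundary (bigD1 e0.1) /=; last first.
    by rewrite -/(src e0) -/(tgt e0) /A !inE b0 a0 eqxx ltxx /= s0 andbF addbF andbT; height_lra.
  by rewrite oddD negb_add => /eqP.
rewrite !key //; congr odd; apply: eq_bigr => l /andP[hx n0].
have [/= Lh|/= Lv] := edge_linkP (l, true).
  apply: (hh (l, true) Lh); move: hx; rewrite -/(src (l, true)) -/(tgt (l, true)) !inE.
  by case: eqP => [->|_]; [left|case: eqP => [->|]; [right|]].
have [a [/andP[c1 c2]|/andP[c1 c2]]] := slab_crossed_vlink Lv hx.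
  by have /andP[? ?] := height_bounds (src (l, true)); exfalso; height_lra.
case/eqP: n0; have [] := vlink_overlap Lv L0; rewrite ?a ?a0 //; first height_lra.
by move=> h1 h2; apply: (link_eq (e := (l, true))).
Qed.

(** * Connectivity *)

(** With no way out through either bounding height, a calm slab is a union of
    connected components, hence avoids a connected [T] that has a vertex
    elsewhere. *)
Lemma slab_isolated T i p r w0 : connected T -> calm T i p r ->
  (forall e, e \in edges T -> vlink (src e) (tgt e) -> aisle (src e) = i ->
     ~ (height (src e) <= p < height (tgt e)) /\
     ~ (height (src e) < r <= height (tgt e))) ->
  w0 \in verts T -> w0 \notin slab i p r ->
  forall w, w \in verts T -> w \notin slab i p r.
Proof.
move=> hT hc hx hw0 n0 w hw.
have cl : closed (sub_adj T) (mem (slab i p r)).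
  move=> u v /existsP[e /andP[he hj]].
  have E : (src e \in slab i p r) = (tgt e \in slab i p r).
    apply/eqP; rewrite -[_ == _]negbK negb_eqb; apply/negP => /(slab_crossed hc he)[L ha].
    by have [h1 h2] := hx e he L ha; case.
  by case/orP: hj => /andP[/eqP/val_inj <- /eqP/val_inj <-]; rewrite !inE in E *; rewrite E.
by rewrite -(closed_connect cl (hT w0 w hw0 hw)).
Qed.

Lemma sub_adj_edge T e : e \in edges T -> sub_adj T (src e) (tgt e).
Proof. by move=> he; apply/existsP; exists e; rewrite he joinsE eqxx. Qed.

Lemma sub_adj_sym T : connect_sym (sub_adj T).
Proof.
apply: sym_connect_sym => u v.
by apply: eq_existsb => e; rewrite /joins orbC.
Qed.

(** Used with [f] collapsing the part of [T] that is absent from [T']. *)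
Lemma connect_retract T T' (f : vertex W -> vertex W) :
  (forall e, e \in edges T -> connect (sub_adj T') (f (src e)) (f (tgt e))) ->
  forall u v, connect (sub_adj T) u v -> connect (sub_adj T') (f u) (f v).
Proof.
move=> hf u v /connectP[s]; elim: s u => [|w s IH] u /=; first by move=> _ ->.
case/andP => /existsP[e /andP[he hj]] hs hv; apply: connect_trans (IH w hs hv).
case/orP: hj => /andP[/eqP/val_inj <- /eqP/val_inj <-]; first exact: hf.
by rewrite sub_adj_sym; apply: hf.
Qed.

Lemma ladder_connect T i p r : (forall e, within i p r e -> e \in edges T) ->
  forall u v, aisle u = i -> aisle v = i -> p <= height u -> height u <= height v ->
  height v <= r -> connect (sub_adj T) u v.
Proof.
move=> hE u v + av pu huv hv; rewrite -av => au; move: u au huv pu; apply: aisle_ind => //.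
move=> u u' L au hu IH pu; have [e [E1 E2]] := vlink_edge L.
have [au' hlt nb] := vlinkP L; apply: (connect_trans (y := u')).
  apply: connect1; rewrite -E1 -E2; apply: sub_adj_edge; apply: hE.
  by apply/and4P; rewrite E1 E2 au av eqxx; split=> //; height_lra.
by apply: IH; height_lra.
Qed.

(** * Lengths *)

Lemma edge_length_vlink e : vlink (src e) (tgt e) ->
  edge_length e = height (tgt e) - height (src e).
Proof. by rewrite /edge_length; case: ifP => // h /(hlink_vlinkF h). Qed.

Lemma edge_length_gt0 e : 0 < edge_length e.
Proof.
case: (edge_linkP e) => [L|L]; first by rewrite /edge_length L dx_gt0.
by rewrite edge_length_vlink // subr_gt0; case/vlinkP: L.
Qed.

(** The lengths telescope along the aisle; the factor 2 comes from the two
    parallel copies of each link. *)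
Lemma sum_within i u v : aisle u = i -> aisle v = i -> height u <= height v ->
  \sum_(e : edge W | within i (height u) (height v) e) edge_length e
  = (height v - height u) *+ 2.
Proof.
move=> + av; rewrite -av; move: u; apply: aisle_ind.
  rewrite subrr mul0rn big_pred0 // => e; apply/negP => /and4P[/vlinkP[_ h _] _ h1 h2].
  height_lra.
move=> u u' L au hu IH; have [e0 [e1 [ne he]]] := vlink_two_edges L.
have [au' hlt nb] := vlinkP L.
have hs e : e \in pred2 e0 e1 -> [/\ src e = u, tgt e = u',
    within (aisle v) (height u) (height v) e & edge_length e = height u' - height u].
  rewrite he => /andP[/eqP E1 /eqP E2].
  have L' : vlink (src e) (tgt e) by rewrite E1 E2.
  by rewrite edge_length_vlink // /within L' E1 E2 au eqxx lexx hu.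
have [|s0 _ w0 l0] := hs e0; first by rewrite inE /= eqxx.
have [|s1 _ w1 l1] := hs e1; first by rewrite inE /= eqxx orbT.
rewrite (bigD1 e0) // (bigD1 e1) ?w1 1?eq_sym //= l0 l1.
rewrite (eq_bigl (within (aisle v) (height u') (height v))); last first.
  move=> e; apply/idP/idP.
    case/andP => /andP[/and4P[L' /eqP a' h1 h2] n0] n1.
    have n2 : e \notin pred2 e0 e1 by rewrite inE /= negb_or n0.
    apply/and4P; split=> //; first exact/eqP.
    case: (nb (src e)) => [|hle|//]; first by rewrite a' au.
    have Eu : src e = u.
      by apply: vertex_eq; rewrite ?a' ?au //; apply/eqP; rewrite eq_le hle h1.
    have [|||_ Et] := vlink_overlap L' L; rewrite ?Eu //.
      by case/vlinkP: L' => _; rewrite Eu.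
    by move: n2; rewrite he Eu Et !eqxx.
  case/and4P => L' /eqP a' h1 h2; rewrite -andbA; apply/and3P; split.
  - by apply/and4P; split=> //; [exact/eqP|height_lra].
  - by apply/eqP => E'; move: h1; rewrite E' s0; height_lra.
  - by apply/eqP => E'; move: h1; rewrite E' s1; height_lra.
by rewrite IH !mulr2n; height_lra.
Qed.

(** * The untraveled part of a segment *)

(** The block runs from the lowest to the highest absent link.  Its interior
    is a calm slab that [T] cannot enter, so no link inside it is present. *)
Lemma untraveled_block T i p r w0 : tour_subgraph T -> calm T i p r ->
  (forall e, within i p r e -> ~~ odd (copies (edges T) e.1)) ->
  (exists2 e, within i p r e & e \notin edges T) ->
  w0 \in verts T -> w0 \notin slab i p r ->
  exists x y, [/\ aisle x = i, aisle y = i, p <= height x < height y /\ height y <= r,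
    forall e, within i p r e ->
      (e \in edges T) = ~~ within i (height x) (height y) e
    & forall w, w \in verts T -> w \notin slab i (height x) (height y)].
Proof.
move=> tT hc ev [e0 h0 n0] hw0 nw0.
pose P e := within i p r e && (e \notin edges T).
have P0 : P e0 by rewrite /P h0.
case: (arg_minP (P := P) (fun e => height (src e)) P0) => e1 /andP[h1 n1] min1.
case: (arg_maxP (P := P) (fun e => height (tgt e)) P0) => e2 /andP[h2 n2] max2.
case/and4P: (h1) => L1 /eqP a1 p1 r1; case/and4P: (h2) => L2 /eqP a2 p2 r2.
have [b1 s1 t1] := vlinkP L1; have [b2 s2 t2] := vlinkP L2.
have m12 : height (tgt e1) <= height (tgt e2) by apply: max2; apply/andP.
have key e e' : e \in edges T -> e' \notin edges T -> within i p r e' ->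
    vlink (src e) (tgt e) -> aisle (src e) = i ->
    height (src e) < height (tgt e') -> height (src e') < height (tgt e) -> False.
  move=> he ne' hw' L ai k1 k2; case/and4P: (hw') => L' /eqP ai' _ _.
  have [||| Es Et] := vlink_overlap L L' => //; first by rewrite ai ai'.
  by rewrite (copies_even_eq (ev _ hw') (link_eq (esym Es) (esym Et))) he in ne'.
have iso w : w \in verts T -> w \notin slab i (height (src e1)) (height (tgt e2)).
  have [_ tcon _] := tT.
  apply: (slab_isolated (w0 := w0)) => //; first exact: calm_sub hc _ _.
    move=> e he L ai; split=> /andP[k1 k2].
      by apply: (key e e1) => //; height_lra.
    by apply: (key e e2) => //; height_lra.
  by apply: contra nw0; rewrite !inE => /andP[-> /=] /andP[? ?]; height_lra.
exists (src e1), (tgt e2); split=> //; first by rewrite b2.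
  by split=> //; height_lra.
move=> e he; apply/idP/idP => [hE|].
  apply/negP => /and4P[L /eqP ai k1 k2]; have [be se te] := vlinkP L.
  have [hs ht] := edges_verts hE.
  have := iso _ hs; have := iso _ ht; rewrite !inE be ai eqxx /= => N1 N2.
  apply: (key e e1) => //; last height_lra.
  rewrite ltNge; apply: contra N2 => ?; height_lra.
apply: contraR => ne; have he' : P e by rewrite /P he.
have := min1 e he'; have := max2 e he'.
by case/and4P: he => L ai _ _ ? ?; apply/and4P.
Qed.

(** Exchange argument: moving the untraveled interval of the segment from
    [x, y] to [x', y'] gives another tour subgraph, which cannot be shorter.
    The last two hypotheses make sure that a doubled stretch of the new
    subgraph hangs from an end of the segment that [T] visits. *)
Lemma gap_maximal T i a b x y x' y' : minimal_tour_subgraph T ->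
  aisle a = i -> aisle b = i -> aisle x = i -> aisle y = i ->
  aisle x' = i -> aisle y' = i ->
  calm T i (height a) (height b) ->
  (forall e, within i (height a) (height b) e ->
     (e \in edges T) = ~~ within i (height x) (height y) e) ->
  height a <= height x -> height x < height y -> height y <= height b ->
  height a <= height x' -> height x' < height y' -> height y' <= height b ->
  (forall w, val w \in locations W -> w \notin slab i (height x') (height y')) ->
  (height a < height x' -> a \in verts T) ->
  (height y' < height b -> b \in verts T) ->
  height y' - height x' <= height y - height x.
Proof.
move=> [tT tmin] aa ab ax ay ax' ay' hc hE lax lxy lyb lax' lxy' lyb' nl va vb.
have [tloc tcon _] := tT.
pose S (e : edge W) := within i (height a) (height b) e.
pose inner (w : vertex W) := w \in slab i (height a) (height b).
pose V := [set w : vertex W | if inner w then (height w <= height x') || (height y' <= height w)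
                   else w \in verts T].
pose F := [set e : edge W | if S e then ~~ within i (height x') (height y') e else e \in edges T].
have outS e : e \in edges T -> ~~ S e -> ~~ inner (src e) /\ ~~ inner (tgt e).
  move=> he nS; case: (edge_linkP e) => [L|L]; first exact: hc.
  have [b1 s1 t1] := vlinkP L.
  have hx z : (z = src e \/ z = tgt e) -> inner z -> S e.
    move=> hz; rewrite /inner inE => /andP[/eqP az /andP[z1 z2]].
    have ai : aisle (src e) = i by case: hz az => -> //; rewrite b1.
    apply/and4P; rewrite ai; split=> //.
    - by case: (t1 a); rewrite ?aa ?ai //; case: hz => E; rewrite E in z1 z2 => ?; height_lra.
    - by case: (t1 b); rewrite ?ab ?ai //; case: hz => E; rewrite E in z1 z2 => ?; height_lra.
  by split; apply: contra nS; apply: hx; [left|right].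
have inS e : S e -> ~~ within i (height x') (height y') e ->
    height (tgt e) <= height x' \/ height y' <= height (src e).
  move=> Se nw; have [|h1] := within_split ax' Se; first by left.
  have [h2|] := within_split ay' Se; last by right.
  by case/negP: nw; case/and4P: Se => L ai _ _; apply/and4P.
have FV e : e \in F -> src e \in V /\ tgt e \in V.
  rewrite !inE; case: ifP => [Se nw|/negbT nS he]; last first.
    have [n1 n2] := outS e he nS.
    by rewrite (negbTE n1) (negbTE n2); apply: edges_verts.
  have hw := inS e Se nw; case/and4P: (Se) => L /eqP ai h1 h2.
  have [b1 s1 t1] := vlinkP L.
  split; case: ifP => hO.
  - by apply/orP; case: hw => ?; [left|right] => //; height_lra.
  - have Ea : src e = a.
      apply: vertex_eq; rewrite ?ai ?aa //; apply/eqP; rewrite eq_le h1 andbT leNgt.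
      by apply: contraFN hO => h; rewrite /inner inE ai eqxx h; height_lra.
    by rewrite Ea in hw s1 *; apply: va; case: hw => ?; height_lra.
  - by apply/orP; case: hw => ?; [left|right] => //; height_lra.
  - have Eb : tgt e = b.
      apply: vertex_eq; rewrite ?b1 ?ai ?ab //; apply/eqP; rewrite eq_le h2 leNgt.
      by apply: contraFN hO => h; rewrite /inner inE b1 ai eqxx h andbT; height_lra.
    by rewrite Eb in hw s1 *; apply: vb; case: hw => ?; height_lra.
pose T' := Subgraph FV.
have par l : odd (copies (edges T) l) = odd (copies (edges T') l).
  have [Sl|nSl] := boolP (S (l, true)).
    have same e p r : e.1 = l -> within i p r e = within i p r (l, true).
      by move=> El; apply: within_link.
    rewrite (copies_uniform (c := ~~ within i (height x) (height y) (l, true))); last first.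
      by move=> e El; rewrite hE same.
    rewrite (copies_uniform (c := ~~ within i (height x') (height y') (l, true))); last first.
      by move=> e El; rewrite inE /S !same // -/(S _) Sl.
    by do 2 case: (~~ _).
  congr odd; rewrite /copies !inE.
  by rewrite -[S (l, false)]/(S (l, true)) (negbTE nSl).
have na : ~~ inner a by rewrite /inner inE ltxx andbF.
have nb : ~~ inner b by rewrite /inner inE ltxx !andbF.
(* Contracting the doubled stretches of [T] onto the ends of the segment turns
   paths of [T] into paths of [T'], as none of them crosses the interval from
   [x] to [y]. *)
pose f w := if inner w then (if height w <= height x then a else b) else w.
have fE e : e \in edges T -> connect (sub_adj T') (f (src e)) (f (tgt e)).
  move=> he; have [Se|nS] := boolP (S e); last first.
    have [n1 n2] := outS e he nS; rewrite /f (negbTE n1) (negbTE n2).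
    by apply/connect1/sub_adj_edge; rewrite inE (negbTE nS).
  have nw : ~~ within i (height x) (height y) e by rewrite -hE.
  have hw : height (tgt e) <= height x \/ height y <= height (src e).
    have [|h1] := within_split ax Se; first by left.
    have [h2|] := within_split ay Se; last by right.
    by case/negP: nw; case/and4P: Se => L ai _ _; apply/and4P.
  case/and4P: (Se) => L /eqP ai h1 h2; have [b1 s1 t1] := vlinkP L.
  suff -> : f (src e) = f (tgt e) by exact: connect0.
  rewrite /f /inner !inE b1 ai eqxx /=; case: hw => hw.
    have -> : height a < height (tgt e) < height b by apply/andP; split; height_lra.
    rewrite hw; case: ifP => H; first by have -> : height (src e) <= height x by height_lra.
    apply: vertex_eq; rewrite ?ai ?aa //; apply/eqP; rewrite eq_le h1 andbT leNgt.
    by apply: contraFN H => h; rewrite h; height_lra.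
  have -> : height a < height (src e) < height b by apply/andP; split; height_lra.
  have -> : (height (src e) <= height x) = false by apply/negbTE; rewrite -ltNge; height_lra.
  have -> : (height (tgt e) <= height x) = false by apply/negbTE; rewrite -ltNge; height_lra.
  case: ifP => H //.
  symmetry; apply: vertex_eq; rewrite ?b1 ?ai ?ab //; apply/eqP; rewrite eq_le h2 leNgt.
  by apply: contraFN H => h; rewrite h andbT; height_lra.
have fV w : w \in V -> exists2 z, z \in verts T & connect (sub_adj T') w (f z).
  rewrite inE; have [Ow|ni hw] := boolP (inner w); last first.
    by exists w => //; rewrite /f (negbTE ni) connect0.
  move: (Ow); rewrite /inner inE => /andP[/eqP aw /andP[w1 w2]].
  case/orP => hw.
    exists a; first by apply: va; height_lra.
    rewrite /f (negbTE na) sub_adj_sym.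
    apply: (@ladder_connect _ i (height a) (height x')) => //; last exact: ltW.
    move=> e /and4P[L ai h1 h2]; have [_ s1 _] := vlinkP L; rewrite inE.
    have -> : S e by apply/and4P; split=> //; height_lra.
    by apply/negP => /and4P[_ _ ? ?]; height_lra.
  exists b; first by apply: vb; height_lra.
  rewrite /f (negbTE nb).
  apply: (@ladder_connect _ i (height y') (height b)) => //; last exact: ltW.
  move=> e /and4P[L ai h1 h2]; have [_ s1 _] := vlinkP L; rewrite inE.
  have -> : S e by apply/and4P; split=> //; height_lra.
  by apply/negP => /and4P[_ _ ? ?]; height_lra.
have T'tour : tour_subgraph T'.
  split.
  - move=> w hw; rewrite inE; case: ifP => [|_]; last exact: tloc.
    rewrite /inner inE => /andP[aw _]; have := nl w hw; rewrite inE aw /= negb_and -!leNgt.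
    by [].
  - move=> u v /fV[u0 hu cu] /fV[v0 hv cv]; apply: connect_trans cu _.
    apply: connect_trans (connect_retract fE (tcon u0 v0 hu hv)) _.
    by rewrite sub_adj_sym.
  - by move=> v _; rewrite -(degree_parity v par); apply: tour_degree.
have := tmin T' T'tour; rewrite /total_length.
rewrite (bigID S) [X in _ <= X](bigID S) /=.
rewrite [X in _ + X <= _](eq_bigl (fun e => (e \in edges T') && ~~ S e)); last first.
  by move=> e; rewrite inE; case: ifP; rewrite ?andbF.
rewrite lerD2r.
have total u v (D : {set edge W}) : aisle u = i -> aisle v = i ->
    height a <= height u -> height u < height v -> height v <= height b ->
    (forall e, S e -> (e \in D) = ~~ within i (height u) (height v) e) ->
    \sum_(e in D | S e) edge_length e =
    (height b - height a) *+ 2 - (height v - height u) *+ 2.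
  move=> au av h1 h2 h3 hD.
  rewrite -(@sum_within i a b) //; last by height_lra.
  rewrite -(@sum_within i u v) //; last exact: ltW.
  apply/eqP; rewrite eq_sym subr_eq; apply/eqP.
  rewrite (bigID (within i (height u) (height v))) /= addrC; congr +%R.
    apply: eq_bigl => e; rewrite andbC; case: (boolP (S e)) => [Se|nS].
      by rewrite hD // -/(S e) Se.
    by rewrite -/(S e) (negbTE nS) !andbF.
  apply: eq_bigl => e; rewrite andb_idl // => /and4P[L ai k1 k2].
  by apply/and4P; split=> //; height_lra.
rewrite (total x y) // (total x' y') //; last by move=> e Se; rewrite inE Se.
by rewrite !mulr2n; height_lra.
Qed.

(** * A tour inside a single aisle *)

(** Two heights enclosing the whole warehouse, so that an entire aisle is a
    slab. *)
Definition below_all : R := -1.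

Definition above_all : R := n.-1%:R * dy W + 1.

Lemma whole_aisle i w : (w \in slab i below_all above_all) = (aisle w == i).
Proof.
rewrite inE; case: eqP => //= _; have /andP[h1 h2] := height_bounds w.
by apply/andP; rewrite /below_all /above_all; split; height_lra.
Qed.

Lemma no_edge_below e r : ~ (height (src e) <= below_all < r).
Proof.
have /andP[h1 h2] := height_bounds (src e).
by rewrite /below_all => /andP[*]; height_lra.
Qed.

Lemma no_edge_above e : ~ (height (src e) < above_all <= height (tgt e)).
Proof.
have /andP[h1 h2] := height_bounds (tgt e).
by rewrite /above_all => /andP[*]; height_lra.
Qed.

(** An aisle without horizontal edges is a union of connected components. *)
Lemma single_aisle T i w0 w : connected T -> calm T i below_all above_all ->
  w0 \in verts T -> w \in verts T -> aisle w = i -> aisle w0 = i.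
Proof.
move=> tcon hc hw0 hw aw; apply/eqP; rewrite -whole_aisle; apply: contraT => nw0.
have := slab_isolated tcon hc _ hw0 nw0 hw.
rewrite whole_aisle aw eqxx; apply=> e _ _ _.
by split; [apply: no_edge_below|apply: no_edge_above].
Qed.

(** Quantifying over the locations, instead of naming the lowest and the
    highest one, makes this meaningful, and false, in an aisle without
    locations. *)
Definition spanned i e :=
  [exists w : vertex W, [&& val w \in locations W, aisle w == i & height w <= height (src e)]]
  && [exists w : vertex W, [&& val w \in locations W, aisle w == i & height (tgt e) <= height w]].

(** If the aisle holds a location then [T] lies inside it, and connectivity
    forces every link between the lowest and the highest location to be
    doubled.  These links already form a tour subgraph, so by minimality [T]
    has no other edge. *)
Lemma lone_aisle T i e : minimal_tour_subgraph T -> calm T i below_all above_all ->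
  vlink (src e) (tgt e) -> aisle (src e) = i ->
  (e \in edges T) = spanned i e.
Proof.
move=> [tT tmin] hc L0 a0; have [tloc tcon tdeg] := tT.
pose P (w : vertex W) := (val w \in locations W) && (aisle w == i).
have [/existsP[w0 P0]|/existsPn noP] := boolP [exists w, P w]; last first.
  have -> : spanned i e = false.
    by apply/negP => /andP[/existsP[w /and3P[h1 h2 _]] _]; case/negP: (noP w); apply/andP.
  apply/negP => /edges_verts[hs _].
  have [d hd] : exists d : vertex W, val d = loc W ord0.
    by apply: location_vertex; apply/imfsetP; exists ord0.
  have dl : val d \in locations W by rewrite hd; apply/imfsetP; exists ord0.
  case/negP: (noP d); rewrite /P dl; apply/eqP.
  by apply: (single_aisle tcon hc _ hs a0); apply: tloc.
case: (arg_minP (P := P) height P0) => lo /andP[llo /eqP alo] minlo.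
case: (arg_maxP (P := P) height P0) => hi /andP[lhi /eqP ahi] maxhi.
have loc_in w : val w \in locations W -> P w.
  move=> hw; rewrite /P hw; apply/eqP.
  exact: (single_aisle tcon hc (tloc w hw) (tloc lo llo) alo).
pose V := [set w : vertex W | (aisle w == i) && (height lo <= height w <= height hi)].
pose F := [set e : edge W | within i (height lo) (height hi) e].
have FV e' : e' \in F -> src e' \in V /\ tgt e' \in V.
  rewrite !inE => /and4P[/vlinkP[-> h _] -> h1 h2] /=.
  by split; apply/andP; split; height_lra.
pose T' := Subgraph FV.
have copiesF l : ~~ odd (copies F l).
  rewrite (copies_uniform (c := within i (height lo) (height hi) (l, true))); first by case: ifP.
  by move=> e' El; rewrite inE; apply: within_link.
have tT' : tour_subgraph T'.
  split.
  - move=> w /loc_in Pw; have /andP[_ aw] := Pw.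
    by rewrite inE aw /=; apply/andP; split; [apply: minlo|apply: maxhi].
  - move=> u v; rewrite !inE => /andP[/eqP au /andP[u1 u2]] /andP[/eqP av /andP[v1 v2]].
    have lad : forall e', within i (height lo) (height hi) e' -> e' \in edges T'.
      by move=> e'; rewrite inE.
    have [h|/ltW h] := leP (height u) (height v); first exact: (ladder_connect lad).
    by rewrite sub_adj_sym; apply: (ladder_connect lad).
  - move=> v _; rewrite /degree.
    have := card_links F (fun l => ((val l).1 == v) || ((val l).2 == v)); rewrite -/(edges T') => ->.
    by rewrite odd_sum big1 // => l _; apply/negbTE.
(* No horizontal edge of [T] or [T'] touches the aisle, so both have the same
   parities there, and in [T'] every link is absent or doubled. *)
have evT e' : vlink (src e') (tgt e') -> aisle (src e') = i -> ~~ odd (copies (edges T) e'.1).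
  move=> L ai; rewrite (same_parity tT tT' _ L ai); first exact: copiesF.
  move=> e1 hl hi1.
  have z E1 : (forall e2, e2.1 = e1.1 -> e2 \notin E1) -> copies E1 e1.1 = 0%N.
    move=> h; apply/eqP; rewrite -leqn0 leqNgt; apply/negP => /copies_gt0[e2 h2 El].
    by rewrite (negbTE (h e2 El)) in h2.
  rewrite !z // => e2 El.
    rewrite inE; apply/negP => /and4P[+ _ _ _]; rewrite /src /tgt El.
    exact: hlink_vlinkF hl.
  apply/negP => he2; have := hc e2 he2; rewrite !whole_aisle /src /tgt El.
  by move=> /(_ hl)[n1 n2]; case: hi1 => E; rewrite -E eqxx in n1 n2.
(* An absent link between the lowest and the highest location would separate
   one from the other. *)
have subF : F \subset edges T.
  apply/subsetP => e1; rewrite inE => /and4P[L /eqP a1 h1 h2].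
  have [b1 s1 t1] := vlinkP L.
  apply: contraT => n1.
  have hc' : calm T i below_all (height (tgt e1)).
    apply: calm_sub hc _ _ => //; have /andP[_ ?] := height_bounds (tgt e1).
    by rewrite /above_all; height_lra.
  have nhi : hi \notin slab i below_all (height (tgt e1)).
    by rewrite inE negb_and; apply/orP; right; rewrite negb_and -!leNgt h2 orbT.
  have := slab_isolated tcon hc' _ (tloc hi lhi) nhi (tloc lo llo).
  have /andP[? _] := height_bounds lo.
  have -> : lo \in slab i below_all (height (tgt e1)).
    by rewrite inE alo eqxx /below_all; apply/andP; split; height_lra.
  apply=> e2 he2 L2 a2; split; first exact: no_edge_below.
  move=> /andP[k1 k2]; have [||| Es Et] := vlink_overlap L2 L => //; first by rewrite a1 a2.
    by height_lra.
  by rewrite (copies_even_eq (evT _ L2 a2) (link_eq Es Et)) (negbTE n1) in he2.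
have -> : (e \in edges T) = (e \in F).
  apply/idP/idP => [he|]; last exact: (subsetP subF).
  apply: contraT => nF.
  have := tmin T' tT'; rewrite /total_length -/F /=.
  rewrite (big_setID F) /= (setIidPr subF) gerDl leNgt => /negP[].
  rewrite (bigD1 e) /=; last by rewrite inE nF.
  by apply: ltr_wpDr; [apply: sumr_ge0 => e1 _; apply: ltW|]; apply: edge_length_gt0.
rewrite inE; apply/idP/idP => [/and4P[_ _ h1 h2]|].
  by apply/andP; split; apply/existsP; [exists lo|exists hi]; apply/and3P; split=> //; apply/eqP.
case/andP => /existsP[w1 /and3P[l1 m1 k1]] /existsP[w2 /and3P[l2 m2 k2]].
have q1 : height lo <= height w1 by apply: minlo; apply/andP.
have q2 : height w2 <= height hi by apply: maxhi; apply/andP.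
by apply/and4P; split=> //; [exact/eqP|height_lra|height_lra].
Qed.

(** * Configurations of the segments *)

Lemma segment_calm T i j k : segment T i j k ->
  calm T i (j%:R * dy W) (k%:R * dy W).
Proof.
case=> _ _ _ h0; apply: hdegree_calm => l ln /andP[].
by rewrite !crossing_lt => h1 h2; apply: h0; rewrite h1.
Qed.

(** Segments are cut only at horizontal edges and at the ends of the aisle. *)
Lemma segment_bottom T i j k : segment T i j k -> hdegree T i j = 0%N -> j = 0%N.
Proof.
case=> /andP[jk kn] + _ _ hd; rewrite /cut hd => /or3P[/eqP //|/eqP E|//].
by move: jk; rewrite E ltnNge -ltnS prednK ?(leq_trans _ kn) // kn.
Qed.

Lemma segment_top T i j k : segment T i j k -> hdegree T i k = 0%N -> k = n.-1.
Proof.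
by case=> /andP[jk kn] _ + _ hd; rewrite /cut hd => /or3P[/eqP E|/eqP //|//]; rewrite E in jk.
Qed.

Lemma segment_calm_below T i j k : segment T i j k -> hdegree T i j = 0%N ->
  calm T i below_all (k%:R * dy W).
Proof.
move=> hs hd; have j0 := segment_bottom hs hd; case: hs => _ _ _ h0.
apply: hdegree_calm => -[|l] ln /andP[_]; first by move=> _; rewrite j0 in hd.
by rewrite crossing_lt => hl; apply: h0; rewrite j0.
Qed.

Lemma segment_calm_above T i j k : segment T i j k -> hdegree T i k = 0%N ->
  calm T i (j%:R * dy W) above_all.
Proof.
move=> hs hd; have kn := segment_top hs hd; case: hs => _ _ _ h0.
apply: hdegree_calm => l ln /andP[]; rewrite crossing_lt => hl _.
have : (l <= k)%N by rewrite kn -ltnS prednK // (leq_trans _ ln).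
by rewrite leq_eqVlt => /orP[/eqP -> //|lk]; apply: h0; rewrite hl.
Qed.

Lemma segment_whole_calm T i j k : segment T i j k ->
  hdegree T i j = 0%N -> hdegree T i k = 0%N -> calm T i below_all above_all.
Proof.
move=> hs dj dk; have Ej := segment_bottom hs dj; have Ek := segment_top hs dk.
case: hs => /andP[jk kn] _ _ h0; apply: hdegree_calm => l ln _.
have [->|l0] := posnP l; first by rewrite -[RHS]dj Ej.
have : (l <= k)%N by rewrite Ek -ltnS prednK // (leq_trans _ ln).
rewrite leq_eqVlt => /orP[/eqP -> //|lk]; apply: h0.
by rewrite Ej l0.
Qed.

Lemma stop_vertex i p r z : stop W i p r z ->
  exists w, [/\ val w \in locations W, w \in slab i p r & height w = z].
Proof.
case=> hl hz; have [w hw] := location_vertex hl; exists w.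
by rewrite inE /aisle /height hw eqxx hz.
Qed.

Lemma vertex_stop i p r w : val w \in locations W -> w \in slab i p r ->
  stop W i p r (height w).
Proof.
move=> hw; rewrite inE => /andP[/eqP aw hz]; split=> //.
by rewrite -aw /aisle /height -surjective_pairing.
Qed.

(** At an end of the segment without horizontal edges, which is an end of the
    aisle, a doubled stretch would be a component of its own; so the untraveled
    interval is flush with such an end, and it is only compared with intervals
    that are flush with the same ends. *)
Lemma maximal_block T i j k a b : minimal_tour_subgraph T -> segment T i j k ->
  val a = crossing W i j -> val b = crossing W i k ->
  ~ has_configuration T i j k TwoPass ->
  (forall e, within i (height a) (height b) e -> ~~ odd (copies (edges T) e.1)) ->
  (0 < hdegree T i j + hdegree T i k)%N ->
  exists x y, [/\ aisle x = i /\ aisle y = i,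
    height a <= height x < height y /\ height y <= height b,
    forall e, within i (height a) (height b) e ->
      (e \in edges T) = ~~ within i (height x) (height y) e,
    forall w, w \in verts T -> w \notin slab i (height x) (height y)
    & [/\ hdegree T i j = 0%N -> height x = height a,
          hdegree T i k = 0%N -> height y = height b
        & forall x' y', aisle x' = i -> aisle y' = i ->
            height a <= height x' -> height x' < height y' -> height y' <= height b ->
            (forall w, val w \in locations W -> w \notin slab i (height x') (height y')) ->
            (hdegree T i j = 0%N -> height x' = height a) ->
            (hdegree T i k = 0%N -> height y' = height b) ->
            height y' - height x' <= height y - height x]].
Proof.
move=> hT hs va vb n2 ev hd; have [tT tmin] := hT; have [tloc tcon tdeg] := tT.
have [Ha Hb] : height a = j%:R * dy W /\ height b = k%:R * dy W by rewrite /height va vb.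
have [aa ab] : aisle a = i /\ aisle b = i by rewrite /aisle va vb.
have hc := segment_calm hs; rewrite -Ha -Hb in hc.
have lab : height a < height b by rewrite Ha Hb crossing_lt; case: hs => /andP[].
have da : (0 < hdegree T i j)%N -> a \in verts T by apply: hdegree_verts.
have db : (0 < hdegree T i k)%N -> b \in verts T by apply: hdegree_verts.
move: va vb => _ _.
have na : a \notin slab i (height a) (height b) by rewrite inE ltxx andbF.
have nb : b \notin slab i (height a) (height b) by rewrite inE ltxx !andbF.
have [w0 hw0 nw0] : exists2 w0, w0 \in verts T & w0 \notin slab i (height a) (height b).
  by move: hd; rewrite addn_gt0 => /orP[/da|/db]; [exists a|exists b].
have hole : exists2 e, within i (height a) (height b) e & e \notin edges T.
  have [/existsP[e /andP[h1 h2]]|/existsPn h] :=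
    boolP [exists e, within i (height a) (height b) e && (e \notin edges T)].
    by exists e.
  case: n2; apply/vmult_betweenP => e; rewrite -Ha -Hb => he.
  by rewrite (copies_even (ev e he)); have := h e; rewrite he negbK => ->.
have [x [y [ax ay [/andP[lax lxy] lyb] hE iso]]] := untraveled_block tT hc ev hole hw0 nw0.
have across e : e \in edges T -> vlink (src e) (tgt e) -> aisle (src e) = i ->
    (height (src e) < height y) -> (height x < height (tgt e)) -> False.
  move=> he L ai k1 k2; have [be se te] := vlinkP L.
  have h1 : height x <= height (src e) by case: (te x); rewrite ?ax ?ai // => ?; height_lra.
  have h2 : height (tgt e) <= height y by case: (te y); rewrite ?ay ?ai // => ?; height_lra.
  have wab : within i (height a) (height b) e.
    by apply/and4P; split=> //; [apply/eqP|height_lra|height_lra].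
  by have := hE e wab; rewrite he => /esym/negP[]; apply/and4P; split=> //; apply/eqP.
have xa : hdegree T i j = 0%N -> height x = height a.
  move=> d0; have dk : (0 < hdegree T i k)%N by rewrite d0 in hd.
  have nv : a \notin verts T.
    apply/negP => hav.
    have cal : calm T i below_all (height y).
      by apply: calm_sub (segment_calm_below hs d0) _ _ => //; rewrite -Hb.
    have nby : b \notin slab i below_all (height y).
      by rewrite inE negb_and negb_and -!leNgt lyb !orbT.
    have /negP[] : a \notin slab i below_all (height y).
      apply: (slab_isolated tcon cal _ (db dk) nby hav) => e he L ai.
      split; first exact: no_edge_below.
      by move=> /andP[k1 k2]; apply: (across e) => //; height_lra.
    have /andP[? _] := height_bounds a.
    by rewrite inE aa eqxx /below_all; apply/andP; split; height_lra.
  apply/eqP; rewrite eq_le lax andbT leNgt; apply/negP => hax.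
  have [v L hv] := vlink_next (etrans ax (esym aa)) hax.
  have [e [E1 E2]] := vlink_edge L; have [_ lv _] := vlinkP L.
  have wab : within i (height a) (height b) e.
    by apply/and4P; rewrite E1 E2; split=> //; [apply/eqP|height_lra].
  case/negP: nv; rewrite -E1; have [] // := @edges_verts _ _ _ _ _ T e _; rewrite hE //.
  by apply/negP => /and4P[_ _ + _]; rewrite E1 => ?; height_lra.
have yb : hdegree T i k = 0%N -> height y = height b.
  move=> d0; have dj : (0 < hdegree T i j)%N by rewrite d0 addn0 in hd.
  have nv : b \notin verts T.
    apply/negP => hbv.
    have cal : calm T i (height x) above_all.
      by apply: calm_sub (segment_calm_above hs d0) _ _ => //; rewrite -Ha.
    have nax : a \notin slab i (height x) above_all.
      by rewrite inE negb_and negb_and -!leNgt lax !orbT.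
    have /negP[] : b \notin slab i (height x) above_all.
      apply: (slab_isolated tcon cal _ (da dj) nax hbv) => e he L ai.
      split; last exact: no_edge_above.
      by move=> /andP[k1 k2]; apply: (across e) => //; height_lra.
    have /andP[_ ?] := height_bounds b.
    by rewrite inE ab eqxx /above_all; apply/andP; split; height_lra.
  apply/eqP; rewrite eq_le lyb leNgt; apply/negP => hyb.
  have [e [E2 L hs']] : exists e, [/\ tgt e = b, vlink (src e) (tgt e) & height y <= height (src e)].
    have [u L hu] := vlink_prev (etrans ay (esym ab)) hyb.
    have [e [E1 E2]] := vlink_edge L.
    by exists e; rewrite E1 E2.
  have [be se te] := vlinkP L.
  have wab : within i (height a) (height b) e.
    apply/and4P; rewrite -be E2 ab eqxx; split=> //; [by rewrite -E2|height_lra].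
  case/negP: nv; rewrite -E2; have [] // := @edges_verts _ _ _ _ _ T e _; rewrite hE //.
  by apply/negP => /and4P[_ _ _ +]; rewrite E2 => ?; height_lra.
exists x, y; split=> //; first by rewrite lax.
split=> // x' y' ax' ay' l1 l2 l3 nl vx vy.
apply: (gap_maximal hT aa ab) => //.
- by move=> hx; apply: da; rewrite lt0n; apply/eqP => /vx E; rewrite E ltxx in hx.
- by move=> hy; apply: db; rewrite lt0n; apply/eqP => /vy E; rewrite E ltxx in hy.
Qed.

(** The configuration is read off the horizontal edges and the locations, so
    that it is visibly the same for two tours with equal horizontal edges.  It
    is meant for even segments with a horizontal edge at one end at least. *)
Definition forced_configuration T i j k : configuration :=
  if [exists w : vertex W, (val w \in locations W) &&
        (w \in slab i (j%:R * dy W) (k%:R * dy W))]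
  then if (0 < hdegree T i j)%N then if (0 < hdegree T i k)%N then Gap else Bottom
       else Top
  else NoneCfg.

(** All four cases compare the untraveled interval of [maximal_block] with the
    interval that the configuration prescribes: the whole segment, the part up
    to the lowest location, the part from the highest location on, or any
    location-free interval. *)
Lemma even_segment_configuration T i j k a b : minimal_tour_subgraph T -> segment T i j k ->
  val a = crossing W i j -> val b = crossing W i k ->
  ~ has_configuration T i j k TwoPass ->
  (forall e, within i (height a) (height b) e -> ~~ odd (copies (edges T) e.1)) ->
  (0 < hdegree T i j + hdegree T i k)%N ->
  has_configuration T i j k (forced_configuration T i j k).
Proof.
move=> hT hs va vb n2 ev hd; have [tT tmin] := hT; have [tloc _ _] := tT.
have [x [y [[ax ay] [/andP[lax lxy] lyb] hE iso [xa yb hmax]]]] :=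
  maximal_block hT hs va vb n2 ev hd.
have [Ha Hb] : height a = j%:R * dy W /\ height b = k%:R * dy W by rewrite /height va vb.
have [aa ab] : aisle a = i /\ aisle b = i by rewrite /aisle va vb.
move: va vb => _ _; have lab : height a < height b by height_lra.
have v0 p r : height x <= p -> r <= height y -> vmult_between T i p r 0.
  move=> h1 h2; apply/vmult_betweenP => e /and4P[L ai k1 k2].
  have [_ se _] := vlinkP L.
  have wab : within i (height a) (height b) e by apply/and4P; split=> //; height_lra.
  rewrite (copies_even (ev e wab)) hE //.
  by have -> : within i (height x) (height y) e by apply/and4P; split=> //; height_lra.
have v2 p r : height a <= p -> r <= height b -> r <= height x \/ height y <= p ->
    vmult_between T i p r 2.
  move=> h1 h2 h3; apply/vmult_betweenP => e /and4P[L ai k1 k2].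
  have [_ se _] := vlinkP L.
  have wab : within i (height a) (height b) e by apply/and4P; split=> //; height_lra.
  rewrite (copies_even (ev e wab)) hE //.
  have -> // : within i (height x) (height y) e = false.
  by apply/negP => /and4P[_ _ ? ?]; case: h3 => ?; height_lra.
rewrite /forced_configuration -Ha -Hb.
pose S w := (val w \in locations W) && (w \in slab i (height a) (height b)).
case: ifP => [/existsP[w0 S0]|/negbT/existsPn nS]; last first.
  rewrite /has_configuration -Ha -Hb.
  have ns w : val w \in locations W -> w \notin slab i (height a) (height b).
    by move=> hw; have := nS w; rewrite hw.
  split; first by move=> z /stop_vertex[w [/ns/negP h1 h2 _]].
  have := hmax a b aa ab; rewrite lexx lexx => H.
  have /= := H isT lab isT ns (fun _ => erefl _) (fun _ => erefl _).
  by move=> ?; apply: v0; height_lra.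
have stop0 : stop W i (height a) (height b) (height w0).
  by case/andP: S0; apply: vertex_stop.
have outside w : S w -> height w <= height x \/ height y <= height w.
  case/andP => hw; rewrite inE => /andP[aw _].
  have := iso w (tloc w hw); rewrite inE aw /= negb_and -!leNgt.
  by case/orP; [left|right].
have in_S w : S w -> aisle w = i /\ (height a < height w < height b).
  by case/andP => _; rewrite inE => /andP[/eqP].
have S_stop z : stop W i (height a) (height b) z -> exists2 w, S w & height w = z.
  by case/stop_vertex => w [h1 h2 <-]; exists w => //; apply/andP.
have slab_S w p r : val w \in locations W -> w \in slab i p r ->
    height a <= p -> r <= height b -> S w.
  move=> hw + h1 h2; rewrite /S hw !inE => /andP[-> /andP[k1 k2]] /=.
  by apply/andP; split; height_lra.
have [dj|dj] := posnP (hdegree T i j).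
  have dk : (0 < hdegree T i k)%N by rewrite dj in hd.
  case: (arg_minP (P := S) height S0) => w Sw minw.
  have {}xa := xa dj; have [aw /andP[w1 w2]] := in_S w Sw.
  have yw : height y <= height w by case: (outside w Sw) => // ?; height_lra.
  have wy : height w <= height y.
    have : height w - height a <= height y - height x.
      apply: hmax => //; [exact: ltW| |by move=> E; rewrite E in dk].
      move=> z hz; apply/negP => hz'; have Sz := slab_S z _ _ hz hz' (lexx _) (ltW w2).
      by move: (minw z Sz) hz'; rewrite inE => ? /andP[_ /andP[_ ?]]; height_lra.
    by move=> ?; height_lra.
  rewrite /has_configuration -Ha -Hb; exists (height w); split.
  - by case/andP: Sw; apply: vertex_stop.
  - by move=> z /S_stop[z' Sz <-]; apply: minw.
  - by apply: v2 => //; [exact: ltW|right].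
  - by apply: v0 => //; rewrite xa.
have [dk|dk] := posnP (hdegree T i k).
  case: (arg_maxP (P := S) height S0) => w Sw maxw.
  have {}yb := yb dk; have [aw /andP[w1 w2]] := in_S w Sw.
  have yw : height w <= height x by case: (outside w Sw) => // ?; height_lra.
  have wy : height x <= height w.
    have : height b - height w <= height y - height x.
      apply: hmax => //; [exact: ltW| |by move=> E; rewrite E in dj].
      move=> z hz; apply/negP => hz'; have Sz := slab_S z _ _ hz hz' (ltW w1) (lexx _).
      by move: (maxw z Sz) hz'; rewrite inE /= => ? /andP[_ /andP[? _]]; height_lra.
    by move=> ?; height_lra.
  rewrite /has_configuration -Ha -Hb; exists (height w); split.
  - by case/andP: Sw; apply: vertex_stop.
  - by move=> z /S_stop[z' Sz <-]; apply: maxw.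
  - by apply: v2 => //; [exact: ltW|left].
  - by apply: v0 => //; rewrite yb.
rewrite /has_configuration -Ha -Hb; split; first by exists (height w0).
exists (height x), (height y); split.
- by split=> //; rewrite lax ltW.
- by split; apply: v2 => //; [height_lra|left|height_lra|right].
- exact: v0.
- move=> z /stop_vertex[w [hw1 hw2 _]]; case/negP: (iso w (tloc w hw1)); exact: hw2.
move=> p r /andP[ap pr] rb ns.
(* A stop-free part extends to one whose ends are stops or ends of the segment. *)
pose P1 w := [&& aisle w == i, (w == a) || S w & height w <= p].
pose P2 w := [&& aisle w == i, (w == b) || S w & r <= height w].
have P1a : P1 a by rewrite /P1 aa !eqxx ap.
have P2b : P2 b by rewrite /P2 ab !eqxx rb.
case: (arg_maxP (P := P1) height P1a) => x' /and3P[/eqP ax' _ xp] maxx.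
case: (arg_minP (P := P2) height P2b) => y' /and3P[/eqP ay' _ yr] miny.
have lx' := maxx a P1a; have ly' := miny b P2b.
have [hle|hlt] := leP (height y') (height x'); first by height_lra.
suff : height y' - height x' <= height y - height x by move=> ?; height_lra.
apply: hmax => //; try by move=> E; rewrite E in dj dk.
move=> w hw; apply/negP => hz; have Sw := slab_S w _ _ hw hz lx' ly'.
have [aw _] := in_S w Sw.
move: hz; rewrite inE => /andP[_ /andP[h1 h2]].
have wp : p < height w.
  rewrite ltNge; apply/negP => h; suff /maxx : P1 w by rewrite /= leNgt h1.
  by rewrite /P1 aw eqxx Sw orbT.
have wr : height w < r.
  rewrite ltNge; apply/negP => h; suff /miny : P2 w by rewrite /= leNgt h2.
  by rewrite /P2 aw eqxx Sw orbT.
apply: (ns (height w)); apply: vertex_stop => //.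
by rewrite inE aw eqxx wp.
Qed.

(** * Comparison of two tours *)

Lemma eq_hdegree T T' i :
  (forall l, (l < n)%N -> (0 < i)%N -> hmult T i.-1 l = hmult T' i.-1 l) ->
  (forall l, (l < n)%N -> (i.+1 < m)%N -> hmult T i l = hmult T' i l) ->
  forall l, (l < n)%N -> hdegree T i l = hdegree T' i l.
Proof.
move=> hleft hright l ln; rewrite /hdegree; congr addn.
  by case: i hleft {hright} => // i hleft; apply: hleft.
have [im|mi] := ltnP i.+1 m; first exact: hright.
have z T1 : hmult T1 i l = 0%N.
  apply: eq_card0 => e; rewrite !inE; apply/negP => /andP[_].
  have F w : val w = crossing W i.+1 l -> False.
    by move=> E; have := aisle_lt w; rewrite /aisle E ltnNge mi.
  by case/orP => /andP[/eqP + /eqP]; [move=> _ /F|move=> /F].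
by rewrite !z.
Qed.

Lemma eq_horizontal_copies T T' i :
  (forall l, (l < n)%N -> (0 < i)%N -> hmult T i.-1 l = hmult T' i.-1 l) ->
  (forall l, (l < n)%N -> (i.+1 < m)%N -> hmult T i l = hmult T' i l) ->
  forall e, hlink (src e) (tgt e) -> aisle (src e) = i \/ aisle (tgt e) = i ->
  copies (edges T) e.1 = copies (edges T') e.1.
Proof.
move=> hleft hright e /hlink_crossing[i' [l [im ln E1 E2]]].
rewrite -!mult_copies E1 E2 /aisle E1 E2 /=.
case=> Ei; first by subst i'; apply: hright.
by subst i; apply: hleft.
Qed.

Lemma eq_segment T T' i j k : (forall l, (l < n)%N -> hdegree T i l = hdegree T' i l) ->
  segment T i j k -> segment T' i j k.
Proof.
move=> hd [jkn cj ck h0]; have /andP[jk kn] := jkn.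
split=> //.
- by rewrite /cut -hd // (ltn_trans jk).
- by rewrite /cut -hd.
- by move=> l /andP[jl lk]; rewrite -hd ?h0 ?jl // (ltn_trans lk).
Qed.

(** One link decides whether the whole segment is odd, in both tours at once.
    In the odd case, and in an aisle without horizontal edges, the two tours
    have the same edges; otherwise they have the same forced configuration. *)
Lemma same_configuration T T' i j k : minimal_tour_subgraph T -> minimal_tour_subgraph T' ->
  no_two_pass T -> no_two_pass T' -> (i < m)%N ->
  (forall l, (l < n)%N -> hdegree T i l = hdegree T' i l) ->
  (forall e, hlink (src e) (tgt e) -> aisle (src e) = i \/ aisle (tgt e) = i ->
     copies (edges T) e.1 = copies (edges T') e.1) ->
  segment T i j k -> same_vertical_configuration T T' i j k.
Proof.
move=> hT hT' n2 n2' hi hd hh hs; have hs' := eq_segment hd hs.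
have [/andP[jk kn] _ _ _] := hs; have jn := ltn_trans jk kn.
have [a va] := crossing_vertex hi jn; have [b vb] := crossing_vertex hi kn.
have [Ha Hb] : height a = j%:R * dy W /\ height b = k%:R * dy W by rewrite /height va vb.
have [aa ab] : aisle a = i /\ aisle b = i by rewrite /aisle va vb.
have [e0 w0] : exists e0, within i (height a) (height b) e0.
  have lab : height a < height b by rewrite Ha Hb crossing_lt.
  have [v L hv] := vlink_next (etrans ab (esym aa)) lab.
  have [e0 [E1 E2]] := vlink_edge L; exists e0.
  by apply/and4P; rewrite E1 E2 aa.
have hc := segment_calm hs; have hc' := segment_calm hs'; rewrite -Ha -Hb in hc hc'.
have par e : within i (height a) (height b) e ->
    odd (copies (edges T) e.1) = odd (copies (edges T) e0.1)
    /\ odd (copies (edges T') e.1) = odd (copies (edges T) e0.1).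
  move=> we; have [L /eqP ai _ _] := and4P we.
  have E := within_parity hT.1 hc we w0.
  by rewrite -(same_parity hT.1 hT'.1 hh L ai).
have [od|ev] := boolP (odd (copies (edges T) e0.1)).
  left; apply: copies_same_vertical_edges => e; rewrite -Ha -Hb => /par[p1 p2].
  by rewrite (copies_odd (etrans p1 od)) (copies_odd (etrans p2 od)).
have [d0|dp] := posnP (hdegree T i j + hdegree T i k).
  have [dj dk] : hdegree T i j = 0%N /\ hdegree T i k = 0%N.
    by move/eqP: d0; rewrite addn_eq0 => /andP[/eqP ? /eqP].
  left; apply: copies_same_vertical_edges => e /and4P[L /eqP ai _ _].
  have cT := segment_whole_calm hs dj dk.
  rewrite hd // in dj; rewrite hd // in dk.
  have cT' := segment_whole_calm hs' dj dk.
  by rewrite /copies !(lone_aisle hT cT) ?(lone_aisle hT' cT').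
right; exists (forced_configuration T i j k); split.
  apply: even_segment_configuration va vb (n2 _ _ _ hi hs) _ dp => //.
  by move=> e /par[-> _].
have -> : forced_configuration T i j k = forced_configuration T' i j k.
  by rewrite /forced_configuration !hd.
apply: even_segment_configuration va vb (n2' _ _ _ hi hs') _ _ => //.
  by move=> e /par[_ ->].
by rewrite -!hd.
Qed.

End Warehouse.

Theorem proposition1 (R : realFieldType) (m n q : nat) (hm : (1 <= m)%N)
    (hn : (2 <= n)%N) (W : warehouse R m n q) (T T' : subgraph W)
    (hT : minimal_tour_subgraph T) (hT' : minimal_tour_subgraph T')
    (h2T : no_two_pass T) (h2T' : no_two_pass T')
    (i : nat) (hi : (i < m)%N)
    (hleft : forall j : nat, (j < n)%N -> (0 < i)%N ->
       hmult T i.-1 j = hmult T' i.-1 j)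
    (hright : forall j : nat, (j < n)%N -> (i.+1 < m)%N ->
       hmult T i j = hmult T' i j) :
  forall j k : nat, segment T i j k ->
    segment T' i j k /\ same_vertical_configuration T T' i j k.
Proof.
move=> j k hs; have hd := eq_hdegree hleft hright.
split; first exact: eq_segment hd hs.
by apply: same_configuration => //; apply: eq_horizontal_copies.
Qed.
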